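(* Let $G$ be a graph and $\theta$ a real number with $\mathrm{mult}(\theta,G)\ge2$, and let $H_1,\dots,H_q$ be the $\theta$-critical components of $G\setminus A_\theta(G)$. For distinct vertices $u,v$, $\mathrm{mult}(\theta,S_\theta(G)\setminus\{u,v\})=\mathrm{mult}(\theta,S_\theta(G))-1$ if and only if either (a) one of $u,v$ lies in $N_\theta(G)$ and the other in $B_\theta(G)$, or (b) $u,v\in V(H_{i_0})$ for some $i_0$ and $\mathrm{mult}(\theta,H_{i_0}\setminus\{u,v\})=0$.
   Context: All graphs are finite and simple. For a graph $G$ on $n$ vertices, let $p(G,r)$ be the number of $r$-matchings of $G$ ($p(G,0)=1$); the matching polynomial is $\mu(G,x)=\sum_{r=0}^{\lfloor n/2\rfloor}(-1)^r p(G,r)x^{n-2r}$. For real $\theta$, $\mathrm{mult}(\theta,G)$ is the multiplicity of $\theta$ as a root of $\mu(G,x)$ (it is $0$ if $\theta$ is not a root). $G\setminus X$ denotes deletion of the vertex set $X$; $G\setminus u=G\setminus\{u\}$. A vertex $u$ is $\theta$-essential, $\theta$-neutral, or $\theta$-positive in $G$ according as $\mathrm{mult}(\theta,G\setminus u)$ equals $\mathrm{mult}(\theta,G)-1$, $\mathrm{mult}(\theta,G)$, or $\mathrm{mult}(\theta,G)+1$. A vertex is $\theta$-special if it is not $\theta$-essential but is adjacent to a $\theta$-essential vertex. $B_\theta(G)$, $A_\theta(G)$, $N_\theta(G)$ are the sets of $\theta$-essential, $\theta$-special, $\theta$-neutral vertices. A connected graph is $\theta$-critical if all its vertices are $\theta$-essential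 in it. $S_\theta(G)$ is the graph on $V(G)$ whose edges are the edges of $G$ together with all pairs $\{w,z\}$, $z\neq w$, with $w\in A_\theta(G)$. *)

(* Defs.v *)
From HB Require Import structures.
From mathcomp Require Import all_boot all_order all_algebra.
Set Implicit Arguments. Unset Strict Implicit. Unset Printing Implicit Defensive.
Import Order.TTheory GRing.Theory Num.Theory.

(* Graphs: a (finite simple) graph is the subgraph induced on a vertex set
   V : {set T} by a symmetric irreflexive relation e : rel T on a finType T.
   Deletion of X is V :\: X. *)

Section Graphs.
Variable T : finType.

Definition is_matching (e : rel T) (V : {set T}) (M : {set {set T}}) : bool :=
  [forall f in M, exists x, exists y,
     [&& f == [set x; y], x \in V, y \in V & e x y]] &&
  [forall f in M, forall g in M, (f != g) ==> [disjoint f & g]].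

Definition nmatch (e : rel T) (V : {set T}) (r : nat) : nat :=
  #|[set M : {set {set T}} | is_matching e V M & #|M| == r]|.

Definition matchpoly (R : nzRingType) (e : rel T) (V : {set T}) : {poly R} :=
  \sum_(r < (#|V| %/ 2).+1)
     ((-1) ^+ r * (nmatch e V r)%:R) *: 'X^(#|V| - 2 * r).

Definition mult (R : rcfType) (theta : R) (e : rel T) (V : {set T}) : nat :=
  mup theta (matchpoly R e V).

Variables (R : rcfType) (theta : R) (e : rel T) (V : {set T}).

Definition essential_set : {set T} :=
  [set u in V | (mult theta e (V :\ u)).+1 == mult theta e V].

Definition neutral_set : {set T} :=
  [set u in V | mult theta e (V :\ u) == mult theta e V].

Definition special_set : {set T} :=
  [set u in V | (u \notin essential_set) &&
                [exists w in essential_set, e u w]].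

Definition S_rel : rel T :=
  fun x y => e x y || ((x != y) && ((x \in special_set) || (y \in special_set))).

End Graphs.

Section Components.
Variables (T : finType) (e : rel T).

Definition induced_rel (W : {set T}) : rel T :=
  fun x y => [&& e x y, x \in W & y \in W].

Definition component (W : {set T}) (x : T) : {set T} :=
  [set y in W | connect (induced_rel W) x y].

Definition components (W : {set T}) : {set {set T}} :=
  [set component W x | x in W].

Definition connectedb (W : {set T}) : bool :=
  (W != set0) && [forall x in W, forall y in W, connect (induced_rel W) x y].

Definition critical (R : rcfType) (theta : R) (H : {set T}) : bool :=
  connectedb H && (essential_set theta e H == H).

End Components.

(* Main.v *)
Require Import Defs.
From HB Require Import structures.
From mathcomp Require Import all_boot all_order all_algebra.
From mathcomp Require Import zify ring lra.
Set Implicit Arguments. Unset Strict Implicit. Unset Printing Implicit Defensive.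
Import Order.TTheory GRing.Theory Num.Theory.
Local Open Scope ring_scope.

(** Write [mu V] for the multiplicity of [theta] in the matching polynomial of
    [V].  Two local facts at [theta], both proved by induction from the vertex
    recurrence, drive everything: the quotient mu(G - u)/mu(G) is decreasing or
    has a simple pole with positive residue (hence interlacing, and [u] is positive
    iff some neighbour of [u] is essential in [G - u]); and the
    Christoffel-Darboux difference mu(G-u)mu(G-v) - mu(G)mu(G-u-v) is a sum of
    squares, so it vanishes to even order.  The recurrence survives adding a
    weighted loop at a vertex, and a well chosen loop makes that order odd
    whenever the stability lemma for special vertices or Gallai's lemma fails.

    Stability gives mu(V - A) = mu(V) + |A| with the same essential and neutral
    vertices, and every component of [V - A] is critical of multiplicity one or
    has multiplicity zero.  In the graph [S] the vertices of [A] are universal,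
    and adding a universal vertex lowers a nonzero multiplicity by exactly one;
    so [theta] has multiplicity mu(V - A - {u,v}) - |A| in [S - {u,v}] when [u]
    and [v] lie outside [A], and the theorem is read off the components. *)

(** * Orders of vanishing at a point, sums of squares, local Nevanlinna functions *)

Section LocalOrder.
Variables (R : rcfType) (t : R).
Implicit Types p q r : {poly R}.
Local Notation D := ('X - t%:P).
Local Notation mu := (mup t).

Lemma mup_factor p : p != 0 -> exists2 r, p = D ^+ mu p * r & r.[t] != 0.
Proof.
move=> p0; have /dvdpP [r Er] : D ^+ mu p %| p by rewrite -mup_geq.
exists r; first by rewrite mulrC.
apply/negP => /eqP rt0; have /factor_theorem [s Es] : root r t by apply/eqP.
have : D ^+ (mu p).+1 %| p by rewrite {2}Er Es -mulrA -exprS dvdp_mulIr.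
by rewrite -mup_geq // ltnn.
Qed.

Lemma mup_XsubC_expM k r : r.[t] != 0 -> mu (D ^+ k * r) = k.
Proof. by move=> rt; rewrite mupMl // mup_XsubCX eqxx. Qed.

Lemma poly_neq0_horner p : p.[t] != 0 -> p != 0.
Proof. by apply: contra_neq => ->; rewrite horner0. Qed.

Lemma XsubC_exp_neq0 k : D ^+ k != 0.
Proof. by rewrite expf_neq0 // polyXsubC_eq0. Qed.

Lemma mupZ (a : R) p : a != 0 -> mu (a *: p) = mu p.
Proof. by move=> a0; rewrite -mul_polyC mupMr ?rootC. Qed.

Lemma mupN p : mu (- p) = mu p.
Proof. by rewrite -scaleN1r mupZ // oppr_eq0 oner_eq0. Qed.

Lemma mup_addl p q : p != 0 -> D ^+ (mu p).+1 %| q ->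
  p + q != 0 /\ mu (p + q) = mu p.
Proof.
move=> p0 dq; have np : ~~ (D ^+ (mu p).+1 %| p) by rewrite -mup_ltn.
have npq : ~~ (D ^+ (mu p).+1 %| p + q) by rewrite dvdp_addl.
have pq0 : p + q != 0 by apply: contraNneq npq => ->; rewrite dvdp0.
split=> //; apply/eqP; rewrite eqn_leq mup_leq // npq /= mup_geq //.
have dp : D ^+ mu p %| p by rewrite -mup_geq.
by rewrite dvdp_addr //; apply: dvdp_trans dq; rewrite dvdp_exp2l.
Qed.

(* Cancellation at order [mu p] can only occur for one choice of the sign. *)
Lemma mup_add_sign p q : p != 0 -> D ^+ mu p %| q ->
  exists2 a : R, a != 0 & mu (p + a *: q) = mu p.
Proof.
move=> p0 /dvdpP [s Es]; have [r Er rt] := mup_factor p0.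
have key (a : R) : (r + a *: s).[t] != 0 -> mu (p + a *: q) = mu p.
  move=> h; rewrite -[RHS](mup_XsubC_expM (mu p) h); congr mup.
  by rewrite {1}Er Es mulrDr -!mul_polyC; ring.
have [h|h] := eqVneq (r + 1 *: s).[t] 0; last by exists 1; rewrite ?oner_eq0 ?key.
exists (-1); first by rewrite oppr_eq0 oner_eq0.
apply: key; move: h rt; rewrite !hornerE => h.
by apply: contra_neq => h'; lra.
Qed.

Lemma mup_deriv p : p != 0 -> (0 < mu p)%N -> ~~ (D ^+ mu p %| p^`()).
Proof.
move=> p0; have [r Er rt] := mup_factor p0.
case: (mu p) Er => // k Er _; rewrite Er derivM deriv_exp.
rewrite dvdp_addl ?dvdp_mulIl // derivXsubC mul1r /= mulrnAl -mulrnAr exprSr.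
rewrite dvdp_mul2l ?XsubC_exp_neq0 // -root_factor_theorem /root hornerMn.
by rewrite mulrn_eq0.
Qed.

(** The trace that a sum of squares leaves at [t]: zero, or even order with positive leading
    coefficient. *)
Definition evenpos p :=
  p = 0 \/ exists k r, p = D ^+ k.*2 * r /\ 0 < r.[t].

Lemma evenpos_sqr p : evenpos (p ^+ 2).
Proof.
have [->|p0] := eqVneq p 0; first by left; rewrite expr0n.
have [r Er rt] := mup_factor p0; right; exists (mu p), (r ^+ 2).
by rewrite {1}Er exprMn -exprM muln2 horner_exp exprn_even_gt0.
Qed.

(** Positive leading coefficients cannot cancel, so the smaller order survives. *)
Lemma evenpos_add_mup p q : evenpos p -> evenpos q -> p != 0 ->
  [/\ evenpos (p + q), p + q != 0 & (mu (p + q) <= mu p)%N].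
Proof.
case=> [->|[k [r [Er rt]]]]; first by rewrite eqxx.
case=> [->|[l [s [Es st]]]] p0; first by rewrite addr0; split=> //; right; exists k, r.
have rt' : r.[t] != 0 by rewrite gt_eqF.
have st' : s.[t] != 0 by rewrite gt_eqF.
suff [j [f [jk E ft]]] : exists j f, [/\ (j <= k)%N, p + q = D ^+ j.*2 * f & 0 < f.[t]].
  have ft' : f.[t] != 0 by rewrite gt_eqF.
  rewrite E; split; first by right; exists j, f.
    by rewrite mulf_neq0 ?XsubC_exp_neq0 ?poly_neq0_horner.
  by rewrite Er !mup_XsubC_expM // leq_double.
have [kl|lk] := leqP k l.
  exists k, (r + D ^+ (l - k).*2 * s); split=> //.
    by rewrite mulrDr mulrA -exprD -doubleD subnKC // Er Es.
  rewrite !hornerE subrr; case: (l - k)%N => [|n] /=.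
    by rewrite mul1r addr_gt0.
  by rewrite expr0n mul0r addr0.
exists l, (s + D ^+ (k - l).*2 * r); split; first exact: ltnW.
  by rewrite mulrDr mulrA -exprD -doubleD subnKC 1?ltnW // Er Es addrC.
rewrite !hornerE subrr.
by rewrite expr0n double_eq0 subn_eq0 leqNgt lk /= mul0r addr0.
Qed.

Lemma evenpos0 : evenpos 0. Proof. by left. Qed.

Lemma evenposD p q : evenpos p -> evenpos q -> evenpos (p + q).
Proof.
move=> hp hq; have [->|p0] := eqVneq p 0; first by rewrite add0r.
by have [] := evenpos_add_mup hp hq p0.
Qed.

Lemma evenpos_odd_mup p : evenpos p -> p != 0 -> ~~ odd (mu p).
Proof.
case=> [->|[k [r [-> rt]]]]; first by rewrite eqxx.
by rewrite mup_XsubC_expM ?gt_eqF // odd_double.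
Qed.

(** Equal to [- q^2 (p/q)'] at [t] when [q.[t] != 0]. Positivity also excludes a common zero at [t]
    and makes a zero of [p] or [q] there simple. *)
Definition wronsk p q := p.[t] * q^`().[t] - p^`().[t] * q.[t].

Lemma wronsk_neq0 p q : 0 < wronsk p q -> p != 0 /\ q != 0.
Proof.
by move=> W; split; apply: contraTneq W => ->;
  rewrite /wronsk deriv0 !horner0 ?mulr0 ?mul0r subrr ltxx.
Qed.

Lemma wronskN p q : wronsk q (- p) = wronsk p q.
Proof. by rewrite /wronsk derivN !hornerN; ring. Qed.

Lemma wronsk_root p q : 0 < wronsk p q -> q.[t] = 0 ->
  p.[t] != 0 /\ exists2 s, q = s * D & 0 < p.[t] * s.[t].
Proof.
move=> W qt; have /factor_theorem [s Es] : root q t by apply/eqP.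
move: W; rewrite /wronsk qt mulr0 subr0 Es derivM derivXsubC !hornerE subrr.
rewrite mulr0 add0r => W; split; last by exists s.
by apply: contraTneq W => ->; rewrite mul0r ltxx.
Qed.

Lemma wronsk_mup p q : 0 < wronsk p q -> mu q = (q.[t] == 0).
Proof.
move=> W; have [qt|qt] := eqVneq q.[t] 0; last by rewrite mupNroot.
have [_ [s -> ps]] := wronsk_root W qt; rewrite mulrC -[D]expr1 mup_XsubC_expM //.
by apply: contraTneq ps => ->; rewrite mulr0 ltxx.
Qed.

(* [nevan p q]: the rational function [p / q], written locally as [a / b], has
   negative derivative at [t], or a simple pole with positive residue there. *)
Definition nevan p q :=
  q != 0 /\ exists a b, p * b = q * a /\ 0 < wronsk a b.

Lemma nevan_neq0 p q : nevan p q -> p != 0.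
Proof.
case=> q0 [a [b [E /wronsk_neq0 [a0 b0]]]]; apply/eqP => p0.
by move/eqP: E; rewrite p0 mul0r eq_sym mulf_eq0 (negPf q0) (negPf a0).
Qed.

(** Stability under [f -> -1/f]: the Wronskian is unchanged when [p, q] become [q, -p]. *)
Lemma nevan_inv p q : nevan (- q) p -> nevan p q.
Proof.
move=> h; have := nevan_neq0 h; rewrite oppr_eq0 => q0.
case: h => p0 [a [b [E W]]]; split=> //; exists (- b), a.
by rewrite -E mulNr mulrN -wronskN opprK.
Qed.

Lemma nevan_NX (c : R) q : q != 0 -> nevan (- (('X + c%:P) * q)) q.
Proof.
move=> q0; split=> //; exists (- ('X + c%:P)), 1; rewrite mulr1 mulrN mulrC.
split=> //; rewrite /wronsk -polyC1 derivC derivN derivD derivX derivC !hornerE; lra.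
Qed.

Lemma nevan_poleE p q a b : nevan p q -> p * b = q * a -> 0 < wronsk a b ->
  (mu q == (mu p).+1) = (b.[t] == 0).
Proof.
move=> h E W; have p0 := nevan_neq0 h; case: h => q0 _.
have [a0 b0] := wronsk_neq0 W.
have := congr1 mu E; rewrite !mupM // (wronsk_mup W).
have [bt|bt] := eqVneq b.[t] 0 => /=.
  by have [at0 _] := wronsk_root W bt; rewrite (mupNroot at0); lia.
by lia.
Qed.

Lemma nevan_mup p q : nevan p q ->
  (mu q <= (mu p).+1)%N /\ (mu p <= (mu q).+1)%N.
Proof.
move=> h; have p0 := nevan_neq0 h; case: h => q0 [a [b [E W]]].
have [a0 b0] := wronsk_neq0 W.
have := congr1 mu E; rewrite !mupM // (wronsk_mup W).
rewrite -(mupN a).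
rewrite (wronsk_mup (p := b) (q := - a)) ?wronskN // hornerN.
by case: (b.[t] == 0); case: (- a.[t] == 0) => /=; lia.
Qed.

(** Positive residues cannot cancel, so the sum has a pole exactly when a summand has one. *)
Lemma nevanD p1 p2 q : nevan p1 q -> nevan p2 q ->
  nevan (p1 + p2) q /\
  (mu q == (mu (p1 + p2)).+1) = (mu q == (mu p1).+1) || (mu q == (mu p2).+1).
Proof.
move=> h1 h2; case: (h1) => q0 [a1 [b1 [E1 W1]]]; case: (h2) => _ [a2 [b2 [E2 W2]]].
rewrite (nevan_poleE h1 E1 W1) (nevan_poleE h2 E2 W2).
suff [a [b [E W <-]]] : exists a b, [/\ (p1 + p2) * b = q * a, 0 < wronsk a b &
    (b.[t] == 0) = (b1.[t] == 0) || (b2.[t] == 0)].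
  have h : nevan (p1 + p2) q by split=> //; exists a, b.
  by rewrite (nevan_poleE h E W).
have [/andP [/eqP z1 /eqP z2]|nz] := boolP ((b1.[t] == 0) && (b2.[t] == 0)).
  have [at1 [c1 Ec1 ac1]] := wronsk_root W1 z1.
  have [at2 [c2 Ec2 ac2]] := wronsk_root W2 z2.
  (* Two simple poles add up to a simple pole: one factor [D] is cancelled, since [b1 * b2] has a
     double zero and would make the Wronskian vanish. *)
  exists (a1 * c2 + a2 * c1), (c1 * c2 * D); split.
  - have -> : (p1 + p2) * (c1 * c2 * D) = p1 * b1 * c2 + p2 * b2 * c1.
      by rewrite Ec1 Ec2; ring.
    by rewrite E1 E2; ring.
  - rewrite /wronsk derivM derivXsubC !hornerE subrr; move: ac1 ac2.
    set x1 := a1.[t]; set x2 := a2.[t]; set y1 := c1.[t]; set y2 := c2.[t] => u1 u2.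
    have y10 : 0 < y1 ^+ 2 by rewrite exprn_even_gt0 //=; apply: contraTneq u1 => ->;
      rewrite mulr0 ltxx.
    have y20 : 0 < y2 ^+ 2 by rewrite exprn_even_gt0 //=; apply: contraTneq u2 => ->;
      rewrite mulr0 ltxx.
    have := addr_gt0 (mulr_gt0 u1 y20) (mulr_gt0 u2 y10).
    by congr (_ < _); rewrite /= !mulr0 subr0; ring.
  - by rewrite !hornerE subrr mulr0 z1 eqxx.
exists (a1 * b2 + a2 * b1), (b1 * b2); split.
- have -> : (p1 + p2) * (b1 * b2) = p1 * b1 * b2 + p2 * b2 * b1 by ring.
  by rewrite E1 E2; ring.
- have -> : wronsk (a1 * b2 + a2 * b1) (b1 * b2)
            = wronsk a1 b1 * b2.[t] ^+ 2 + wronsk a2 b2 * b1.[t] ^+ 2.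
    by rewrite /wronsk derivD !derivM !(hornerD, hornerM); ring.
  move: nz; rewrite negb_and => /orP [n1|n2].
    by apply: ltr_wpDl; [rewrite mulr_ge0 ?sqr_ge0 ?ltW | rewrite mulr_gt0 ?exprn_even_gt0].
  by apply: ltr_pwDl; [rewrite mulr_gt0 ?exprn_even_gt0 | rewrite mulr_ge0 ?sqr_ge0 ?ltW].
- by rewrite hornerE mulf_eq0.
Qed.

(** Shaped after the vertex recurrence: for [q = M (V :\ u)] and summands [M (V :\ u :\ w)], [p] is
    [- M V]. The linear term adds no pole. *)
Lemma nevan_NX_sum (c : R) (q : {poly R}) (I : Type) (s : seq I) (P : pred I)
    (f : I -> {poly R}) :
  q != 0 -> (forall i, P i -> nevan (f i) q) ->
  let p := - (('X + c%:P) * q) + \sum_(i <- s | P i) f i in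
  nevan p q /\
  (mu q == (mu p).+1) = has (fun i => P i && (mu q == (mu (f i)).+1)) s.
Proof.
move=> q0 hf; elim: s => [|i s [IH1 IH2]] /=.
  rewrite big_nil addr0; have h := nevan_NX c q0; split=> //.
  rewrite (nevan_poleE h (b := 1) (a := - ('X + c%:P))); first by rewrite hornerE oner_eq0.
    by ring.
  by rewrite /wronsk -polyC1 derivC derivN derivD derivX derivC !hornerE; lra.
rewrite big_cons; case: ifP => Pi //=.
by rewrite addrCA; have [h1 ->] := nevanD (hf i Pi) IH1; rewrite IH2.
Qed.

End LocalOrder.

(** * The vertex recurrence: interlacing, Christoffel-Darboux differences, derivative *)

Lemma setD1C (T : finType) (V : {set T}) u v : V :\ u :\ v = V :\ v :\ u.
Proof. by rewrite !setDDl setUC. Qed.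

(* The recurrence of the matching polynomial of a graph with a loop of weight
   [- c u] at each vertex [u]. *)
Definition matchsys (T : finType) (R : rcfType) (e : rel T) (c : T -> R)
    (M : {set T} -> {poly R}) :=
  M set0 = 1 /\ forall (V : {set T}) u, u \in V -> M V =
    ('X + (c u)%:P) * M (V :\ u) - \sum_(w in V :\ u | e u w) M (V :\ u :\ w).

Section MatchingSystem.
Variables (T : finType) (R : rcfType) (e : rel T) (c : T -> R).
Variables (M : {set T} -> {poly R}) (t : R).
Hypothesis sysM : matchsys e c M.
Implicit Types (V : {set T}) (u v w : T).
Local Notation mu V := (mup t (M V)).

(** By induction the ratios [M (V :\ u :\ w) / M (V :\ u)] satisfy [nevan]; the recurrence adds them
    up to [- M V / M (V :\ u)], and [nevan_inv] concludes. *)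
Lemma matchsys_nevan V u : u \in V -> nevan t (M (V :\ u)) (M V) /\
  (mu (V :\ u) == (mu V).+1) =
  [exists w in V :\ u, e u w && (mu (V :\ u) == (mu (V :\ u :\ w)).+1)].
Proof.
have [n] := ubnP #|V|; elim: n V u => // n IH V u; rewrite ltnS => Vn uV.
have IHu w : w \in V :\ u -> nevan t (M (V :\ u :\ w)) (M (V :\ u)).
  move=> wV; have [|] := IH (V :\ u) w _ wV; rewrite //.
  by rewrite (leq_trans _ Vn) // [#|V|](cardsD1 u) uV.
have q0 : M (V :\ u) != 0.
  have [->|[w /IHu []] //] := set_0Vmem (V :\ u).
  by rewrite sysM.1 oner_eq0.
have := @nevan_NX_sum R t (c u) (M (V :\ u)) T (index_enum T)
  (fun w => (w \in V :\ u) && e u w) (fun w => M (V :\ u :\ w)) q0.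
case=> [w /andP [/IHu //]|].
set p := _ + _; have -> : p = - M V by rewrite (sysM.2 _ _ uV) /p opprB addrC.
move=> h1 h2; split; first exact: nevan_inv.
rewrite mupN in h2; rewrite h2; apply/hasP/existsP.
  by case=> w _ /andP [/andP [w1 w2] w3]; exists w; rewrite w1 w2.
by case=> w /andP [w1 /andP [w2 w3]]; exists w; rewrite ?mem_index_enum // w1 w2.
Qed.

Lemma matchsys_neq0 V : M V != 0.
Proof.
have [->|[u /matchsys_nevan [[]]] //] := set_0Vmem V.
by rewrite sysM.1 oner_eq0.
Qed.

Lemma mu_D1 V u : u \in V -> (mu V <= (mu (V :\ u)).+1)%N /\ (mu (V :\ u) <= (mu V).+1)%N.
Proof. by move=> /matchsys_nevan [/nevan_mup]. Qed.

Lemma positiveP V u : u \in V ->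
  reflect (exists w, [/\ w \in V :\ u, e u w & mu (V :\ u) = (mu (V :\ u :\ w)).+1])
          (mu (V :\ u) == (mu V).+1).
Proof.
move=> uV; rewrite (matchsys_nevan uV).2; apply: (iffP existsP).
  by case=> w /and3P [w1 w2 /eqP w3]; exists w.
by case=> w [w1 w2 /eqP w3]; exists w; rewrite w1 w2.
Qed.

(** Unfolding [cdiff_rec] gives the sum of [M (V :\: P) ^+ 2] over the paths [P] from [u] to [v] in
    [V]. *)
Definition cdiff V u v := M (V :\ u) * M (V :\ v) - M V * M (V :\ u :\ v).

(** [M V] and [M (V :\ v)] are both expanded at [u]; the terms in ['X + c u] cancel. *)
Lemma cdiff_rec V u v : u \in V -> v \in V -> u != v ->
  cdiff V u v = (if e u v then M (V :\ u :\ v) ^+ 2 else 0) +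
    \sum_(w in V :\ u :\ v | e u w) cdiff (V :\ u) w v.
Proof.
move=> uV vV uv; rewrite /cdiff.
have uVv : u \in V :\ v by rewrite !inE uv.
have vVu : v \in V :\ u by rewrite !inE eq_sym uv.
have -> : \sum_(w in V :\ u :\ v | e u w) (M (V :\ u :\ w) * M (V :\ u :\ v)
     - M (V :\ u) * M (V :\ u :\ w :\ v)) =
   (\sum_(w in V :\ u :\ v | e u w) M (V :\ u :\ w)) * M (V :\ u :\ v)
   - M (V :\ u) * \sum_(w in V :\ u :\ v | e u w) M (V :\ u :\ v :\ w).
  rewrite sumrB mulr_suml mulr_sumr; congr (_ - _).
  by apply: eq_bigr => w _; rewrite [in RHS]setD1C.
rewrite {1}(sysM.2 _ _ uVv) {1}(sysM.2 _ _ uV) setD1C.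
have -> : \sum_(w in V :\ u | e u w) M (V :\ u :\ w) =
  (if e u v then M (V :\ u :\ v) else 0) + \sum_(w in V :\ u :\ v | e u w) M (V :\ u :\ w).
  case: ifP => euv.
    rewrite (bigD1 v) ?vVu //=; congr (_ + _); apply: eq_bigl => w.
    by rewrite !inE; case: (w == v); rewrite ?andbF ?andbT.
  rewrite add0r; apply: eq_bigl => w; rewrite !inE.
  by have [->|] := eqVneq w v; rewrite ?euv ?andbF.
by case: ifP => _; ring.
Qed.

Lemma cdiff_evenpos V u v : u \in V -> v \in V -> u != v -> evenpos t (cdiff V u v).
Proof.
have [n] := ubnP #|V|; elim: n V u => // n IH V u; rewrite ltnS => Vn uV vV uv.
rewrite cdiff_rec //; apply: evenposD.
  by case: ifP => _; [exact: evenpos_sqr | exact: evenpos0].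
apply: (big_ind (evenpos t)) => [|p q|w]; [exact: evenpos0 | exact: evenposD |].
rewrite !inE => /andP [/and3P [w1 w2 w3] euw].
apply: IH; rewrite ?inE ?w2 ?w3 // ?(eq_sym v) ?uv //.
by rewrite (leq_trans _ Vn) // [#|V|](cardsD1 u) uV.
Qed.

(** If the two products in [cdiff] have different orders, the smaller one is the order of [cdiff],
    hence even. *)
Lemma mu_parity V u v : u \in V -> v \in V -> u != v ->
  let x := (mu (V :\ u) + mu (V :\ v))%N in
  let y := (mu V + mu (V :\ u :\ v))%N in
  ((x < y) -> ~~ odd x)%N /\ ((y < x) -> ~~ odd y)%N.
Proof.
move=> uV vV uv x y; have hE := cdiff_evenpos uV vV uv.
have Ex : mup t (M (V :\ u) * M (V :\ v)) = x by rewrite mupM ?matchsys_neq0.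
have Ey : mup t (- (M V * M (V :\ u :\ v))) = y by rewrite mupN mupM ?matchsys_neq0.
have nx : M (V :\ u) * M (V :\ v) != 0 by rewrite mulf_neq0 ?matchsys_neq0.
have ny : - (M V * M (V :\ u :\ v)) != 0 by rewrite oppr_eq0 mulf_neq0 ?matchsys_neq0.
split=> lt; rewrite -?Ex -?Ey.
  have [|h0 <-] := mup_addl (t := t) (q := - (M V * M (V :\ u :\ v))) nx.
    by rewrite Ex -mup_geq // Ey.
  exact: evenpos_odd_mup hE h0.
have [|h0 <-] := mup_addl (t := t) (q := M (V :\ u) * M (V :\ v)) ny.
  by rewrite Ey -mup_geq // Ex.
by rewrite addrC; apply: evenpos_odd_mup hE _; rewrite /cdiff addrC.
Qed.

(** For an edge, [M (V :\ u :\ v) ^+ 2] is one of the squares in [cdiff], so it bounds the order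
    [k.*2] of [cdiff] from above; the two products bound it from below. *)
Lemma mu_edge V u v : u \in V -> v \in V -> u != v -> e u v ->
  exists k, [/\ (k <= mu (V :\ u :\ v))%N &
    (minn (mu (V :\ u) + mu (V :\ v)) (mu V + mu (V :\ u :\ v)) <= k.*2)%N].
Proof.
move=> uV vV uv euv; have hE := cdiff_evenpos uV vV uv.
have s0 : M (V :\ u :\ v) ^+ 2 != 0 by rewrite expf_neq0 ?matchsys_neq0.
have [|_ h0 h1] := evenpos_add_mup (evenpos_sqr t (M (V :\ u :\ v)))
  (q := \sum_(w in V :\ u :\ v | e u w) cdiff (V :\ u) w v) _ s0.
  apply: (big_ind (evenpos t)) => [|p q|w]; [exact: evenpos0 | exact: evenposD |].
  rewrite !inE => /andP [/and3P [w1 w2 w3] _].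
  by apply: cdiff_evenpos; rewrite ?inE ?w2 ?w3 // ?(eq_sym v) ?uv.
have := cdiff_rec uV vV uv; rewrite euv => Ec; rewrite -Ec in h0 h1.
have := evenpos_odd_mup hE h0; rewrite -dvdn2 => /dvdnP [k Ek].
exists k; split.
  by move: h1; rewrite Ek expr2 mupM ?matchsys_neq0 //; lia.
rewrite -muln2 -Ek mup_geq // /cdiff dvdp_sub //.
  by rewrite -mup_geq ?mulf_neq0 ?matchsys_neq0 // mupM ?matchsys_neq0 // geq_minl.
by rewrite -mup_geq ?mulf_neq0 ?matchsys_neq0 // mupM ?matchsys_neq0 // geq_minr.
Qed.

Lemma matchsys_deriv V : (M V)^`() = \sum_(u in V) M (V :\ u).
Proof.
have [n] := ubnP #|V|; elim: n V => // n IH V; rewrite ltnS => Vn.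
have [->|[u uV]] := set_0Vmem V.
  by rewrite sysM.1 big_set0 -polyC1 derivC.
have cu : (#|V :\ u| < n)%N by rewrite (leq_trans _ Vn) // [#|V|](cardsD1 u) uV.
rewrite (bigD1 u) //= {1}(sysM.2 _ _ uV) derivB derivM derivD derivX derivC addr0 mul1r.
rewrite -addrA; congr (_ + _).
rewrite IH // mulr_sumr raddf_sum /=.
have E1 : \sum_(w in V :\ u | e u w) (M (V :\ u :\ w))^`() =
   \sum_(v in V :\ u) \sum_(w in V :\ u :\ v | e u w) M (V :\ u :\ v :\ w).
  transitivity (\sum_(w in V :\ u | e u w) \sum_(v in V :\ u :\ w) M (V :\ u :\ w :\ v)).
    apply: eq_bigr => w /andP [wV _]; apply: IH.
    by rewrite (leq_trans _ cu) // ltnS [#|V :\ u|](cardsD1 w) wV ltnW.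
  rewrite (exchange_big_dep (mem (V :\ u))) /=; last first.
    by move=> w v _; rewrite !inE => /andP [].
  apply: eq_bigr => v vV; apply: eq_big => [w|w _]; last by rewrite setD1C.
  move: vV; rewrite !inE => ->; rewrite !(eq_sym v).
  by case: (w == v); rewrite ?andbF ?andbT.
rewrite E1 -sumrB; apply: eq_big => [v|v vV]; first by rewrite !inE andbC.
have uVv : u \in V :\ v by move: vV; rewrite !inE eq_sym uV => /andP [->].
by rewrite [RHS](sysM.2 _ _ uVv) !(setD1C V v).
Qed.

(** Without an essential vertex the derivative of [M V] would vanish to order [mu V], against
    [mup_deriv]. *)
Lemma essential_exists V : (0 < mu V)%N ->
  exists2 u, u \in V & (mu (V :\ u)).+1 = mu V.
Proof.
move=> m0; have := mup_deriv (matchsys_neq0 V) m0.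
rewrite matchsys_deriv => nd.
suff /existsP [u /andP [uV /eqP h]] : [exists u in V, (mu (V :\ u)).+1 == mu V] by exists u.
apply: contraR nd; rewrite negb_exists => /forallP h.
apply: (big_ind (fun p => _ %| p)) => [|p q|u uV]; [exact: dvdp0 | exact: dvdp_add |].
rewrite -mup_geq ?matchsys_neq0 //.
by have := h u; rewrite uV /= ; have := mu_D1 uV; lia.
Qed.

End MatchingSystem.

(** * Adding a weighted loop at one vertex *)

Section Loop.
Variables (T : finType) (R : rcfType) (e : rel T) (c : T -> R).
Variables (M : {set T} -> {poly R}) (t : R).
Hypothesis sysM : matchsys e c M.
Implicit Types (V : {set T}) (u v w : T).

(** The recurrence is affine in [c u]: raising this weight by [a] adds [a *: M (V :\ u)]. *)
Definition add_loop u (a : R) V := if u \in V then M V + a *: M (V :\ u) else M V.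

Lemma matchsys_add_loop u a :
  matchsys e (fun x => if x == u then c u + a else c x) (add_loop u a).
Proof.
split=> [|V v vV]; first by rewrite /add_loop inE sysM.1.
rewrite /add_loop; have [vu|uv] := eqVneq v u; last first.
  rewrite 2!inE eq_sym (negPf uv) /=; have [uV|uV] := boolP (u \in V); last first.
    rewrite [LHS](sysM.2 _ _ vV); congr (_ - _); apply: eq_bigr => w _.
    by rewrite !inE (negPf uV) !andbF.
  have uVv : u \in V :\ v by rewrite !inE eq_sym uv.
  have vVu : v \in V :\ u by rewrite !inE uv.
  rewrite (sysM.2 _ _ vV) (sysM.2 _ _ vVu) setD1C.
  have -> : \sum_(w in V :\ v | e v w)
      (if u \in V :\ v :\ w then M (V :\ v :\ w) + a *: M (V :\ v :\ w :\ u)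
       else M (V :\ v :\ w))
    = \sum_(w in V :\ v | e v w) M (V :\ v :\ w)
      + a *: \sum_(w in V :\ v :\ u | e v w) M (V :\ v :\ u :\ w).
    rewrite scaler_sumr big_mkcond /= [X in _ = X + _]big_mkcond [X in _ = _ + X]big_mkcond /=.
    rewrite -big_split; apply: eq_bigr => w _ /=.
    rewrite [u \in _ :\ w]in_setD1 [w \in _ :\ u]in_setD1 uVv andbT (eq_sym u) -andbA.
    case: ifP => _; rewrite ?andbF ?addr0 // andbT.
    by have [_|_] := eqVneq w u; rewrite /= ?addr0 // [V :\ v :\ u :\ w]setD1C.
  by rewrite -!mul_polyC; ring.
move: vV; rewrite vu => uV; rewrite uV !inE eqxx /= [M V](sysM.2 _ _ uV).
have -> : \sum_(w in V :\ u | e u w)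
    (if u \in V :\ u :\ w then M (V :\ u :\ w) + a *: M (V :\ u :\ w :\ u)
     else M (V :\ u :\ w)) = \sum_(w in V :\ u | e u w) M (V :\ u :\ w).
  by apply: eq_bigr => w _; rewrite !inE eqxx andbF.
by rewrite polyCD -mul_polyC; ring.
Qed.

Local Notation mu V := (mup t (M V)).
Local Notation muL u a V := (mup t (add_loop u a V)).

Lemma mu_add_loop_lt V u a : u \in V -> (mu V < mu (V :\ u))%N -> muL u a V = mu V.
Proof.
move=> uV lt; rewrite /add_loop uV.
have [|_ ->] // := mup_addl (t := t) (q := a *: M (V :\ u)) (matchsys_neq0 t sysM V).
by rewrite -mul_polyC dvdp_mull // -mup_geq ?(matchsys_neq0 t sysM).
Qed.

Lemma mu_add_loop_gt V u a : u \in V -> a != 0 -> (mu (V :\ u) < mu V)%N ->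
  muL u a V = mu (V :\ u).
Proof.
move=> uV a0 lt; rewrite /add_loop uV addrC.
have n0 : a *: M (V :\ u) != 0 by rewrite scaler_eq0 (negPf a0) (matchsys_neq0 t sysM).
have [|_ ->] := mup_addl (t := t) (q := M V) n0; rewrite mupZ //.
by rewrite -mup_geq ?(matchsys_neq0 t sysM).
Qed.

(** This covers equal orders too, where cancellation can only raise the order. *)
Lemma mu_add_loop_ge V u a k : (k <= mu V)%N -> (k <= mu (V :\ u))%N -> (k <= muL u a V)%N.
Proof.
move=> h1 h2; rewrite mup_geq ?(matchsys_neq0 t (matchsys_add_loop u a)) //.
rewrite /add_loop; case: ifP => _; last by rewrite -mup_geq ?(matchsys_neq0 t sysM).
by rewrite dvdp_add // -?mul_polyC ?dvdp_mull // -mup_geq ?(matchsys_neq0 t sysM).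
Qed.

End Loop.

(** * Stability for special vertices and Gallai's lemma *)

Section Stability.
Variables (T : finType) (R : rcfType) (e : rel T) (c : T -> R).
Variables (M : {set T} -> {poly R}) (t : R).
Hypothesis sysM : matchsys e c M.
Hypothesis e_irr : irreflexive e.
Implicit Types (V : {set T}) (u v w : T).
Local Notation mu V := (mup t (M V)).
Let intl := mu_D1 t sysM.

Lemma edge_neq u v : e u v -> u != v.
Proof. by apply: contraTneq => ->; rewrite e_irr. Qed.

Lemma special_positive V u w : u \in V -> w \in V -> e u w ->
  (mu (V :\ w)).+1 = mu V -> (mu V <= mu (V :\ u))%N -> mu (V :\ u) = (mu V).+1.
Proof.
move=> uV wV euw dw du; have uw := edge_neq euw.
have uVw : u \in V :\ w by rewrite !inE uw.
have [k [k1]] := mu_edge t sysM uV wV uw euw.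
have [] := mu_parity t sysM uV wV uw.
have := intl uV; have := intl uVw; rewrite setD1C; lia.
Qed.

(** Any other value allowed by interlacing would give [cdiff] the odd order [2 mu V - 1]. *)
Lemma neutral_essential V v w : v \in V -> w \in V -> v != w ->
  (mu (V :\ w)).+1 = mu V -> mu (V :\ v) = mu V -> mu (V :\ v :\ w) = mu (V :\ w).
Proof.
move=> vV wV vw dw dv; have wVv : w \in V :\ v by rewrite !inE eq_sym vw.
have [] := mu_parity t sysM vV wV vw.
have := intl wVv; lia.
Qed.

Lemma positive_essential V v w : v \in V -> w \in V -> v != w ->
  (mu (V :\ w)).+1 = mu V -> mu (V :\ v) = (mu V).+1 -> mu (V :\ v :\ w) = mu V.
Proof.
move=> vV wV vw dw dv; have wVv : w \in V :\ v by rewrite !inE eq_sym vw.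
have vVw : v \in V :\ w by rewrite !inE vw.
have := intl wVv; have := intl vVw; rewrite setD1C; lia.
Qed.

(** A drop by two would give both products in [cdiff] order [2 mu V - 2], too high for the square of
    order [2 mu V - 4] that the edge contributes. *)
Lemma essential_edge V u v : u \in V -> v \in V -> e u v ->
  (mu (V :\ u)).+1 = mu V -> (mu (V :\ v)).+1 = mu V ->
  (mu V <= (mu (V :\ u :\ v)).+1)%N.
Proof.
move=> uV vV euv du dv; have uv := edge_neq euv.
have vVu : v \in V :\ u by rewrite !inE eq_sym uv.
have [k [k1]] := mu_edge t sysM uV vV uv euv.
have := intl vVu; lia.
Qed.

(* If deleting [u] made a positive [v] essential, a loop at [u] would make [v]
   neutral and [cdiff v w] vanish to odd order. *)
Theorem stability V u v w : u \in V -> v \in V -> w \in V -> u != v -> e u w ->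
  (mu (V :\ w)).+1 = mu V -> (mu V <= mu (V :\ u))%N ->
  mu (V :\ u :\ v) = (mu (V :\ v)).+1.
Proof.
move=> uV vV wV uv euw dw du; have uw := edge_neq euw.
have duE := special_positive uV wV euw dw du.
have vVu : v \in V :\ u by rewrite !inE eq_sym uv.
have uVv : u \in V :\ v by rewrite !inE uv.
have [|Ev] := eqVneq (mu (V :\ v)).+1 (mu V).
  by move=> Ev; rewrite (positive_essential uV vV uv Ev duE).
have vw : v != w by apply: contra_neq Ev => ->.
have wVv : w \in V :\ v by rewrite !inE eq_sym vw.
have key : (mu (V :\ v :\ w)).+1 = mu (V :\ v) ->
   (mu (V :\ v) <= mu (V :\ v :\ u))%N -> mu (V :\ v :\ u) = (mu (V :\ v)).+1.
  by move=> h1 h2; apply: special_positive h1 h2.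
have [Ev0|Ev0] := eqVneq (mu (V :\ v)) (mu V).
  rewrite setD1C key // ?(neutral_essential vV wV vw dw Ev0) ?Ev0 //.
  by have := intl vVu; rewrite setD1C; clear -duE; lia.
have Ev1 : mu (V :\ v) = (mu V).+1 by have := intl vV; clear -Ev Ev0; lia.
have Evw := positive_essential vV wV vw dw Ev1.
rewrite setD1C; have [h|h] := leqP (mu (V :\ v)) (mu (V :\ v :\ u)).
  by apply: key; rewrite // Evw.
have Euv : (mu (V :\ v :\ u)).+1 = mu (V :\ v) by have := intl uVv; clear -h; lia.
have Euvw : (mu V <= mu (V :\ v :\ u :\ w))%N.
  have := essential_edge uVv wVv euw Euv; rewrite Evw Ev1 => /(_ erefl).
  by clear; lia.
(* With [m = mu V], the loop gives [V], [V :\ v], [V :\ w] the orders [m], [m], [m - 1], and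
   [V :\ v :\ w] at least [m]: [cdiff] at [v, w] would have order [2m - 1]. *)
have sysL := matchsys_add_loop sysM u 1.
have Euw := positive_essential uV wV uw dw duE.
have L0 : mup t (add_loop M u 1 V) = mu V by rewrite (mu_add_loop_lt sysM) ?duE.
have L1 : mup t (add_loop M u 1 (V :\ v)) = mu V.
  by rewrite (mu_add_loop_gt sysM) ?oner_eq0 //; clear -Euv Ev1; lia.
have L2 : mup t (add_loop M u 1 (V :\ w)) = mu (V :\ w).
  by rewrite (mu_add_loop_lt sysM) // ?inE ?uw // setD1C; clear -dw Euw; lia.
have L3 : (mu V <= mup t (add_loop M u 1 (V :\ v :\ w)))%N.
  by rewrite (mu_add_loop_ge sysM) ?Evw // [V :\ v :\ w :\ u]setD1C.
have [] := mu_parity t sysL vV wV vw; rewrite L0 L1 L2.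
by clear -dw L3; lia.
Qed.

(* A loop at [v] turns a failure of transitivity into an odd order of vanishing
   of [cdiff u w]. *)
Lemma inseparable_trans V u v w : u \in V -> v \in V -> w \in V ->
  u != v -> v != w -> u != w ->
  (mu (V :\ v)).+1 = mu V ->
  (mu V <= (mu (V :\ u)).+1)%N -> (mu V <= (mu (V :\ w)).+1)%N ->
  (mu V <= (mu (V :\ u :\ v)).+1)%N -> (mu V <= (mu (V :\ v :\ w)).+1)%N ->
  (mu V <= (mu (V :\ u :\ w)).+1)%N.
Proof.
move=> uV vV wV uv vw uw dv du dw duv dvw.
have wVu : w \in V :\ u by rewrite !inE eq_sym uw.
have [//|h] := leqP (mu V) (mu (V :\ u :\ w)).+1.
have duw : (mu (V :\ u :\ w)).+2 = mu V by have := intl wVu; lia.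
have wVuv : w \in V :\ u :\ v by rewrite !inE !(eq_sym w) vw uw.
have vVuw : v \in V :\ u :\ w by rewrite !inE vw (eq_sym v) uv.
(* The weight is chosen to keep the order of [V :\ u :\ w] at [mu V - 2]. The order of [V] becomes
   [mu V - 1], those of [V :\ u] and [V :\ w] are at least that, so [cdiff] at [u, w] would have
   order [2 mu V - 3]. *)
have [|a a0 La] := mup_add_sign (t := t) (q := M (V :\ u :\ w :\ v))
  (matchsys_neq0 t sysM (V :\ u :\ w)).
  rewrite -mup_geq ?(matchsys_neq0 t sysM) //.
  by have := intl wVuv; rewrite [V :\ u :\ v :\ w]setD1C; clear -duv duw; lia.
have sysL := matchsys_add_loop sysM v a.
have L0 : mup t (add_loop M v a V) = mu (V :\ v).
  by rewrite (mu_add_loop_gt sysM) // -dv.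
have L1 : (mu (V :\ v) <= mup t (add_loop M v a (V :\ u)))%N.
  by apply: (mu_add_loop_ge sysM); clear -dv du duv; lia.
have L2 : (mu (V :\ v) <= mup t (add_loop M v a (V :\ w)))%N.
  by apply: (mu_add_loop_ge sysM); rewrite ?[V :\ w :\ v]setD1C; clear -dv dw dvw; lia.
have L3 : mup t (add_loop M v a (V :\ u :\ w)) = mu (V :\ u :\ w).
  by rewrite /add_loop vVuw.
have [] := mu_parity t sysL uV wV uw; rewrite L0 L3.
by clear -dv duw L1 L2; lia.
Qed.

(** The relation [close] holds along edges by [essential_edge] and propagates along paths by
    [inseparable_trans], hence holds between any two vertices. If [mu V >= 2], an essential vertex
    [v] of [V :\ u] gives a pair that loses two. *)
Theorem gallai V : connectedb e V -> (forall u, u \in V -> (mu (V :\ u)).+1 = mu V) ->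
  mu V = 1%N.
Proof.
case/andP=> /set0Pn [u uV] /forall_inP conn ess.
pose close x y := x = y \/ (mu V <= (mu (V :\ x :\ y)).+1)%N.
have close_path p x : x \in V -> path (induced_rel e V) x p ->
    last x p \in V /\ close x (last x p).
  elim: p x => [|y p IH] x xV /=; first by split=> //; left.
  case/andP=> /and3P [exy _ yV] /(IH y yV) [lV cl]; split=> //.
  have cxy : (mu V <= (mu (V :\ x :\ y)).+1)%N by apply: essential_edge; rewrite ?ess.
  case: cl => [<-|cl]; [by right | have [->|xl] := eqVneq x (last y p); [by left | right]].
  have [<- //|yl] := eqVneq y (last y p).
  by apply: (inseparable_trans (v := y)); rewrite ?ess // edge_neq.
have m0 : (0 < mu V)%N by rewrite -(ess u uV).
have [//|m2] := eqVneq (mu V) 1%N.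
have [|v vVu dv] := essential_exists sysM (t := t) (V := V :\ u).
  by have := ess u uV; lia.
have /andP [vu vV] : (v != u) && (v \in V) by move: vVu; rewrite !inE.
have /forall_inP/(_ v vV)/connectP [p pth lst] := conn u uV.
have [_ []] := close_path p u uV pth; rewrite -lst; first by move/eqP; rewrite eq_sym (negPf vu).
by have := ess u uV; lia.
Qed.

End Stability.

(** * Matchings and the recurrence of the matching polynomial *)

Section MatchpolyRecurrence.
Variables (T : finType) (e : rel T).
Hypotheses (e_sym : symmetric e) (e_irr : irreflexive e).
Implicit Types (V f : {set T}) (Q : {set {set T}}) (u v w : T).

Lemma is_matchingP V Q :
  reflect ((forall f, f \in Q ->
             exists x y, [/\ f = [set x; y], x \in V, y \in V & e x y])
           /\ trivIset Q) (is_matching e V Q).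
Proof.
apply: (iffP andP) => [[/forall_inP h1 /forall_inP h2]|[h1 /trivIsetP h2]]; split.
- move=> f /h1 /existsP [x /existsP [y /and4P [/eqP E xV yV exy]]].
  by exists x, y.
- apply/trivIsetP => f g fQ gQ fg.
  by move: (h2 f fQ) => /forall_inP /(_ g gQ) /implyP /(_ fg).
- apply/forall_inP => f /h1 [x [y [-> xV yV exy]]].
  by apply/existsP; exists x; apply/existsP; exists y; rewrite eqxx xV yV.
- by apply/forall_inP => f fQ; apply/forall_inP => g gQ; apply/implyP; apply: h2.
Qed.

Lemma matching_sub V Q f : is_matching e V Q -> f \in Q -> f \subset V.
Proof.
by case/is_matchingP=> h _ /h [x [y [-> xV yV _]]]; rewrite subUset !sub1set xV.
Qed.

Lemma matching_card V Q : is_matching e V Q -> (2 * #|Q| <= #|V|)%N.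
Proof.
move=> mQ; have /is_matchingP [h tQ] := mQ.
have [_] := leq_card_cover Q; rewrite tQ => /eqP Ec.
have -> : (2 * #|Q| = \sum_(f in Q) #|f|)%N.
  rewrite -sum1_card big_distrr /=; apply: eq_bigr => f /h [x [y [-> _ _ exy]]].
  by rewrite cards2 (edge_neq e_irr exy).
by rewrite -Ec subset_leq_card //; apply/bigcupsP => f; apply: matching_sub.
Qed.

Lemma matchpolyE (R : nzRingType) V : matchpoly R e V =
  \sum_(Q | is_matching e V Q) (-1) ^+ #|Q| *: 'X^(#|V| - 2 * #|Q|).
Proof.
(* [inord] never takes its default value here, as [matching_card] bounds [#|Q|] by [#|V| %/ 2]. *)
rewrite (partition_big (fun Q => inord #|Q| : 'I_(#|V| %/ 2).+1) xpredT) //=.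
apply: eq_bigr => r _; rewrite /nmatch mulr_natr.
transitivity (\sum_(Q | is_matching e V Q && (#|Q| == r))
    (-1) ^+ r *: 'X^(#|V| - 2 * r) : {poly R}).
  rewrite sumr_const scalerMnl; congr (_ *: _); congr (_ *+ _).
  by apply: eq_card => Q; rewrite !inE.
apply: eq_big => [Q|Q /andP [_ /eqP -> //]].
apply/andb_id2l => mQ; rewrite -val_eqE /= inordK // ltnS leq_divRL // mulnC.
exact: matching_card mQ.
Qed.

Lemma is_matchingD1 V u Q :
  is_matching e (V :\ u) Q = is_matching e V Q && (u \notin cover Q).
Proof.
apply/idP/andP=> [mQ|[/is_matchingP [h tQ] uQ]].
  have /is_matchingP [h tQ] := mQ; split.
    apply/is_matchingP; split=> // f /h [x [y [-> ]]]; rewrite !inE.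
    by case/andP=> _ xV /andP [_ yV] exy; exists x, y.
  apply/bigcupP => [[f fQ uf]].
  by have /subsetP/(_ u uf) := matching_sub mQ fQ; rewrite !inE eqxx.
apply/is_matchingP; split=> // f fQ; have [x [y [E xV yV exy]]] := h f fQ.
exists x, y; rewrite !inE xV yV !andbT; split=> //; apply: contraNneq uQ => Eu;
  by apply/bigcupP; exists f; rewrite // E -Eu !inE eqxx ?orbT.
Qed.

(** The condition [[set u; w] \notin Q] makes adding the edge injective, as the reindexing in
    [matchpoly_rec] needs. *)
Lemma is_matching_addedge V u w Q : u \in V -> w \in V -> e u w ->
  is_matching e V ([set u; w] |: Q) && ([set u; w] \notin Q) =
  is_matching e (V :\ u :\ w) Q.
Proof.
move=> uV wV euw; apply/andP/idP=> [[/is_matchingP [h tQ] nQ]|mQ].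
  rewrite !is_matchingD1 -andbA -negb_or; apply/andP; split.
    apply/is_matchingP; split=> [f fQ|]; first by apply: h; rewrite !inE fQ orbT.
    by apply: trivIsetS tQ; apply: subsetUr.
  have dis x : x \in [set u; w] -> x \notin cover Q.
    move=> xf; apply/bigcupP => [[g gQ xg]].
    have /trivIsetP/(_ [set u; w] g) := tQ; rewrite !inE eqxx gQ orbT => /(_ isT isT).
    have gn : [set u; w] != g by apply: contraNneq nQ => ->.
    by move=> /(_ gn) /pred0P /(_ x) /=; rewrite xf xg.
  by rewrite negb_or !dis // !inE eqxx ?orbT.
have := mQ; rewrite !is_matchingD1 -andbA => /and3P [/is_matchingP [h tQ] uQ wQ].
have nQ : [set u; w] \notin Q.
  by apply: contra uQ => fQ; apply/bigcupP; exists [set u; w]; rewrite // !inE eqxx.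
split=> //; apply/is_matchingP; split=> [f|].
  by rewrite !inE => /orP [/eqP ->|/h //]; exists u, w.
apply: trivIsetU => //; first exact: trivIset1.
rewrite cover1 -setI_eq0; apply/eqP/setP => x; rewrite !inE.
by apply/negbTE/negP => /andP [/orP [] /eqP -> xQ]; [rewrite xQ in uQ | rewrite xQ in wQ].
Qed.

Lemma matching_partner V u w Q : is_matching e V Q -> [set u; w] \in Q ->
  u != w -> odflt u [pick z | (z != u) && ([set u; z] \in Q)] = w.
Proof.
move=> /is_matchingP [_ /trivIsetP tQ] wQ uw.
case: pickP => [z /andP [zu zQ]|/(_ w)] /=; last by rewrite wQ eq_sym uw.
apply/eqP; apply: contraT => zw.
have /(tQ _ _ zQ wQ) : [set u; z] != [set u; w].
  by apply: contra zw => /eqP /setP /(_ z); rewrite !inE eqxx orbT (negPf zu) /=.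
by move/pred0P => /(_ u) /=; rewrite !inE eqxx.
Qed.

Lemma matchpoly_rec (R : comNzRingType) V u : u \in V -> matchpoly R e V =
  'X * matchpoly R e (V :\ u) - \sum_(w in V :\ u | e u w) matchpoly R e (V :\ u :\ w).
Proof.
move=> uV; have cV : #|V| = #|V :\ u|.+1 by rewrite (cardsD1 u) uV.
rewrite [LHS]matchpolyE (bigID (fun Q : {set {set T}} => u \notin cover Q)) /=; congr (_ + _).
  rewrite matchpolyE mulr_sumr; apply: eq_big => Q; first by rewrite is_matchingD1.
  rewrite -is_matchingD1 => /matching_card cQ.
  by rewrite -scalerAr -exprS cV subSn.
(* The partner of [u] in [Q]. The matchings covering [u] are sorted by it; the default [u] occurs
   for none of them. *)
pose h Q := odflt u [pick z | (z != u) && ([set u; z] \in Q)].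
have hP Q : is_matching e V Q -> ~~ (u \notin cover Q) ->
    [/\ h Q \in V :\ u, e u (h Q) & [set u; h Q] \in Q].
  move=> mQ /negPn /bigcupP [f fQ uf].
  have [x [y [Ef xV yV exy]]] := (is_matchingP _ _ mQ).1 f fQ.
  have xy := edge_neq e_irr exy.
  have [w [Efw wV euw]] : exists w, [/\ f = [set u; w], w \in V & e u w].
    move: uf; rewrite Ef !inE => /orP [] /eqP ->; first by exists y.
    by exists x; rewrite setUC e_sym.
  have uw := edge_neq e_irr euw.
  have -> : h Q = w by apply: (matching_partner mQ); rewrite -?Efw.
  by rewrite !inE eq_sym uw -Efw.
rewrite (partition_big h (fun w => (w \in V :\ u) && e u w)) /=; last first.
  by move=> Q /andP [mQ uQ]; have [-> ->] := hP Q mQ uQ.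
rewrite -sumrN; apply: eq_bigr => w /andP [wVu euw].
have wV : w \in V by move: wVu; rewrite !inE => /andP [].
have uw := edge_neq e_irr euw.
have cVu : #|V :\ u| = #|V :\ u :\ w|.+1 by rewrite (cardsD1 w) wVu.
rewrite (reindex_onto (fun Q => [set u; w] |: Q) (fun Q => Q :\ [set u; w])) /=; last first.
  move=> Q /andP [/andP [mQ uQ] /eqP hQ]; have [_ _] := hP Q mQ uQ; rewrite hQ; apply: setD1K.
rewrite matchpolyE -sumrN; apply: eq_big => Q.
  rewrite -(is_matching_addedge Q uV wV euw).
  have [mQ|//] := boolP (is_matching e V ([set u; w] |: Q)) => /=.
  have fQ : [set u; w] \in [set u; w] |: Q by rewrite setU11.
  have -> : u \in cover ([set u; w] |: Q).
    by apply/bigcupP; exists [set u; w]; rewrite // !inE eqxx.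
  rewrite /h (matching_partner mQ fQ uw) eqxx /=.
  have [nQ|nQ] := boolP ([set u; w] \in Q) => /=; last by rewrite setU1K ?eqxx.
  by apply/negbTE/eqP => /setP /(_ [set u; w]); rewrite !inE eqxx nQ.
move=> /andP [/andP [/andP [mQ _] _] /eqP EQ].
have nQ : [set u; w] \notin Q by rewrite -EQ !inE eqxx.
have := matching_card mQ; rewrite cardsU1 nQ cV cVu add1n => cQ.
rewrite exprS mulN1r scaleNr; congr (- (_ *: 'X^ _)); lia.
Qed.

Lemma matchpoly0 (R : nzRingType) : matchpoly R e set0 = 1.
Proof.
rewrite /matchpoly cards0 big_ord_recl big_ord0 addr0 expr0 mul1r expr0.
suff -> : nmatch e set0 0 = 1%N by rewrite scale1r.
rewrite /nmatch (_ : [set _ | _] = [set set0]) ?cards1 //.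
apply/setP => Q; rewrite !inE cards_eq0; apply: andb_idl => /eqP ->.
by apply/is_matchingP; split=> [f|]; [rewrite inE | apply/trivIsetP => A B; rewrite inE].
Qed.

Lemma matchsys_matchpoly (R : rcfType) : matchsys e (fun=> 0) (@matchpoly T R e).
Proof.
by split=> [|V u uV]; [exact: matchpoly0 | rewrite addr0; exact: matchpoly_rec].
Qed.

End MatchpolyRecurrence.

(** * Disjoint unions and dependence on the induced subgraph only *)

Section Locality.
Variables (T : finType) (R : rcfType) (e : rel T) (c : T -> R).
Variables (M : {set T} -> {poly R}).
Hypothesis sysM : matchsys e c M.
Implicit Types (V W : {set T}) (u v w : T).

Lemma matchsys_disjointU V W : [disjoint V & W] ->
  (forall x y, x \in V -> y \in W -> ~~ e x y) -> M (V :|: W) = M V * M W.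
Proof.
have [n] := ubnP #|V|; elim: n V => // n IH V; rewrite ltnS => Vn dVW eVW.
have [->|[u uV]] := set_0Vmem V; first by rewrite set0U sysM.1 mul1r.
have uW : u \notin W by rewrite (disjointFr dVW uV).
have D1E x (X : {set T}) : x \in V -> (X :|: W) :\ x = X :\ x :|: W.
  move=> xV; rewrite setDUl; congr (_ :|: _); apply/setDidPl.
  by rewrite disjoint_sym disjoints1 (disjointFr dVW xV).
have sub (X : {set T}) : X \subset V -> (#|X| < n)%N -> M (X :|: W) = M X * M W.
  move=> /subsetP XV Xn; apply: IH => // [|x y /XV]; last exact: eVW.
  by apply: disjointWl dVW; apply/subsetP.
have cu : (#|V :\ u| < n)%N by rewrite (leq_trans _ Vn) // [#|V|](cardsD1 u) uV.
have uVW : u \in V :|: W by rewrite inE uV.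
rewrite (sysM.2 _ _ uVW) (sysM.2 _ _ uV) mulrBl D1E // sub ?subD1set // mulrA.
congr (_ - _); rewrite mulr_suml; apply: eq_big => [w|w].
  rewrite !inE; have [wW|wW] := boolP (w \in W); last by rewrite orbF.
  by rewrite (negPf (eVW u w uV wW)) !andbF.
case/andP=> wVW euw; have wVu : w \in V :\ u.
  by move: wVW; rewrite inE => /orP [//|wW]; rewrite (negPf (eVW u w uV wW)) in euw.
rewrite D1E ?sub // ?(subset_trans (subD1set _ _)) ?subD1set //.
  by rewrite (leq_trans _ cu) // ltnS subset_leq_card ?subD1set.
by move: wVu; rewrite inE => /andP [].
Qed.

Lemma matchsys_ext (e' : rel T) (M' : {set T} -> {poly R}) V : matchsys e' c M' ->
  {in V &, e =2 e'} -> M V = M' V.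
Proof.
move=> sysM'; have [n] := ubnP #|V|; elim: n V => // n IH V; rewrite ltnS => Vn ee'.
have [->|[u uV]] := set_0Vmem V; first by rewrite sysM.1 sysM'.1.
have cu : (#|V :\ u| < n)%N by rewrite (leq_trans _ Vn) // [#|V|](cardsD1 u) uV.
have sub (X : {set T}) : X \subset V :\ u -> M X = M' X.
  move=> XV; apply: IH; first exact: leq_ltn_trans (subset_leq_card XV) cu.
  by move=> x y /(subsetP XV) /setD1P [_ xV] /(subsetP XV) /setD1P [_ yV]; apply: ee'.
rewrite (sysM.2 _ _ uV) (sysM'.2 _ _ uV) sub //; congr (_ - _).
apply: eq_big => [w|w _]; last by rewrite sub ?subD1set.
by rewrite !inE; case: (boolP (w \in V)) => wV; rewrite ?andbF // ee'.
Qed.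

End Locality.

(** * Connected components *)

Section Components.
Variables (T : finType) (e : rel T).
Hypothesis e_sym : symmetric e.
Implicit Types (W H : {set T}) (x y z : T).

Lemma induced_rel_sym W : connect_sym (induced_rel e W).
Proof.
by apply: sym_connect_sym => x y; rewrite /induced_rel e_sym [(x \in W) && _]andbC.
Qed.

Lemma mem_component W x : x \in W -> x \in component e W x.
Proof. by move=> xW; rewrite inE xW connect0. Qed.

Lemma component_sub W x : component e W x \subset W.
Proof. by apply/subsetP => y; rewrite inE => /andP []. Qed.

Lemma component_eq W x y : y \in component e W x -> component e W y = component e W x.
Proof.
rewrite inE => /andP [_ xy]; apply/setP => z; rewrite !inE.
by rewrite (same_connect (induced_rel_sym W) xy).
Qed.

Lemma component_edge W x y z : y \in component e W x -> z \in W -> e y z ->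
  z \in component e W x.
Proof.
rewrite !inE => /andP [yW xy] zW eyz; rewrite zW; apply: connect_trans xy (connect1 _).
by rewrite /induced_rel eyz yW.
Qed.

(** Connectedness is required inside the component itself, so the path in [W] is shown never to
    leave it. *)
Lemma component_connected W x : x \in W -> connectedb e (component e W x).
Proof.
move=> xW; apply/andP; split; first by apply/set0Pn; exists x; exact: mem_component.
apply/forall_inP => y yH; apply/forall_inP => z zH.
have : z \in component e W y by rewrite (component_eq yH).
rewrite inE => /andP [_ {zH}] /connectP [p]; elim: p y yH => [|a p IH] y yH /= => [_ ->|].
  exact: connect0.
case/andP=> /and3P [eya yW aW] pth lst.
have aH := component_edge yH aW eya.
apply: connect_trans (connect1 _) (IH a aH pth lst).
by rewrite /induced_rel eya yH.
Qed.

End Components.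

(** * Deleting the special vertices *)

Section SpecialVertices.
Variables (T : finType) (R : rcfType) (t : R) (e : rel T).
Hypotheses (e_sym : symmetric e) (e_irr : irreflexive e).
Implicit Types (V W H X : {set T}) (u v w x : T).
Local Notation mu := (mult t e).
Let sysM := matchsys_matchpoly e_sym e_irr R.

Lemma mult_D1 V u : u \in V -> (mu V <= (mu (V :\ u)).+1)%N /\ (mu (V :\ u) <= (mu V).+1)%N.
Proof. exact: (mu_D1 t sysM). Qed.

Lemma mult_essential_exists V : (0 < mu V)%N ->
  exists2 u, u \in V & (mu (V :\ u)).+1 = mu V.
Proof. exact: (essential_exists sysM). Qed.

Lemma essentialE V u : u \in V -> (u \in essential_set t e V) = ((mu (V :\ u)).+1 == mu V).
Proof. by rewrite inE => ->. Qed.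

Lemma specialP V u : u \in special_set t e V ->
  [/\ u \in V, (mu V <= mu (V :\ u))%N &
      exists w, [/\ w \in V, e u w & (mu (V :\ w)).+1 = mu V]].
Proof.
rewrite inE => /and3P [uV nu /existsP [w /andP []]].
rewrite inE => /andP [wV /eqP dw] euw; split=> //; last by exists w.
by move: nu; rewrite essentialE //; have := mult_D1 uV; lia.
Qed.

Lemma special_mult V u : u \in special_set t e V -> mu (V :\ u) = (mu V).+1.
Proof.
move=> /specialP [uV du [w [wV euw dw]]].
exact: (special_positive sysM e_irr uV wV euw dw du).
Qed.

Lemma special_stability V u v : u \in special_set t e V -> v \in V -> u != v ->
  mu (V :\ u :\ v) = (mu (V :\ v)).+1.
Proof.
move=> /specialP [uV du [w [wV euw dw]]] vV uv.
exact: (stability sysM e_irr uV vV wV uv euw dw du).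
Qed.

Lemma essential_set_D1special V u : u \in special_set t e V ->
  essential_set t e (V :\ u) = essential_set t e V.
Proof.
move=> uA; apply/setP => v; rewrite !in_set in_set1.
have [->|vu] /= := eqVneq v u.
  by rewrite (special_mult uA) gtn_eqF ?andbF.
case: (boolP (v \in V)) => //= vV.
by rewrite special_stability // 1?eq_sym // special_mult // eqSS.
Qed.

Lemma special_set_D1special V u : u \in special_set t e V ->
  special_set t e (V :\ u) = special_set t e V :\ u.
Proof.
move=> uA; apply/setP => v; rewrite [LHS]in_set [RHS]in_setD1 [in RHS]in_set.
by rewrite essential_set_D1special // in_setD1 -andbA.
Qed.

(** Special vertices are deleted one at a time: by stability the others stay special and each
    multiplicity grows by one. *)
Lemma mult_del_special V : let A := special_set t e V in
  mu (V :\: A) = (mu V + #|A|)%N /\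
  forall v, v \in V :\: A -> mu (V :\: A :\ v) = (mu (V :\ v) + #|A|)%N.
Proof.
move=> A; have [n] := ubnP #|A|; rewrite {}/A; elim: n V => // n IH V; rewrite ltnS => An.
have [->|[u uA]] := set_0Vmem (special_set t e V).
  by rewrite setD0 cards0 addn0; split=> // v _; rewrite addn0.
have cA := cardsD1 u (special_set t e V); rewrite uA in cA.
have E : V :\ u :\: (special_set t e V :\ u) = V :\: special_set t e V.
  by apply/setP => x; rewrite !(in_setD, in_set1); have [->|//] := eqVneq x u; rewrite uA.
have [|h1 h2] := IH (V :\ u); first by rewrite special_set_D1special //; lia.
rewrite special_set_D1special // E in h1 h2; split=> [|v vW].
  by rewrite h1 special_mult // cA addSnnS.
have /andP [vA vV] : (v \notin special_set t e V) && (v \in V) by rewrite -in_setD.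
have uv : u != v by apply: contraNneq vA => <-.
by rewrite h2 // special_stability // cA addSnnS.
Qed.

Lemma essential_set_delspecial V :
  essential_set t e (V :\: special_set t e V) = essential_set t e V.
Proof.
have [h1 h2] := mult_del_special V; apply/setP => v.
have [vA|vA] := boolP (v \in special_set t e V).
  rewrite [LHS]in_set in_setD vA /=.
  by move: vA; rewrite in_set => /and3P [_ /negbTE ->].
rewrite [LHS]in_set [RHS]in_set in_setD vA /=; case: (boolP (v \in V)) => //= vV.
by rewrite h1 h2 ?in_setD ?vA // -addSn eqn_add2r.
Qed.

Lemma special_set_delspecial V : special_set t e (V :\: special_set t e V) = set0.
Proof.
apply/setP => v; rewrite [RHS]in_set0 [LHS]in_set essential_set_delspecial in_setD.
by rewrite [v \in special_set _ _ _]in_set; case: (v \in V) => //=; rewrite andbT andNb.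
Qed.

(** The free set [X] lets one splitting serve both before and after deleting vertices. *)
Lemma mult_component W x X : let H := component e W x in
  mu (W :\: X) = (mu (H :\: X) + mu (W :\: H :\: X))%N.
Proof.
move=> H; have Hsub : H \subset W := component_sub e W x.
have -> : W :\: X = (H :\: X) :|: (W :\: H :\: X) by rewrite -setDUl -{1}(setIidPr Hsub) setID.
rewrite /mult (matchsys_disjointU sysM) ?mupM ?(matchsys_neq0 t sysM) //.
  rewrite -setI_eq0; apply/eqP/setP => y; rewrite !(in_setI, in_setD, in_set0).
  by case: (y \in H); rewrite ?andbF.
move=> y z /setDP [yH _] /setDP [/setDP [zW zH] _].
by apply: contra zH => eyz; apply: component_edge eyz.
Qed.

(** Without special vertices, being essential spreads along edges. *)
Lemma essential_component W x y z : special_set t e W = set0 ->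
  y \in component e W x -> z \in component e W x ->
  (y \in essential_set t e W) = (z \in essential_set t e W).
Proof.
move=> noA yH; rewrite -(component_eq e_sym yH) inE => /andP [_].
apply: closed_connect => {x y z yH} y z /and3P [eyz yW zW].
have half a b : a \in W -> e a b -> b \in essential_set t e W -> a \in essential_set t e W.
  move=> aW eab bB; apply: contraT => aB.
  suff : a \in special_set t e W by rewrite noA inE.
  by rewrite inE aW aB; apply/existsP; exists b; rewrite bB.
by apply/idP/idP; apply: half => //; rewrite e_sym.
Qed.

End SpecialVertices.

(** * Adding universal vertices *)

Section UniversalVertices.
Variables (T : finType) (R : rcfType) (t : R) (e : rel T).
Hypotheses (e_sym : symmetric e) (e_irr : irreflexive e).

(** While the multiplicity is nonzero there is an essential vertex; a new universal vertex is
    adjacent to it, hence positive by [positiveP]. The bound on [#|K|] keeps the multiplicity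
    nonzero before each addition. *)
Lemma mult_universal (Y K : {set T}) : [disjoint Y & K] ->
  {in K, forall a x, a != x -> e a x} -> (#|K| <= mult t e Y)%N ->
  (mult t e (Y :|: K) + #|K|)%N = mult t e Y.
Proof.
have [n] := ubnP #|K|; elim: n K => // n IH K; rewrite ltnS => Kn dYK univ cK.
have [->|[a aK]] := set_0Vmem K; first by rewrite setU0 cards0 addn0.
have cKa := cardsD1 a K; rewrite aK in cKa.
have sKa := subD1set K a.
have IHa : (mult t e (Y :|: K :\ a) + #|K :\ a|)%N = mult t e Y.
  apply: IH; [lia | exact: disjointWr dYK | | lia].
  by move=> b /(subsetP sKa); apply: univ.
have aY : a \notin Y by rewrite (disjointFl dYK aK).
have E : (Y :|: K) :\ a = Y :|: K :\ a.
  by rewrite setDUl; congr (_ :|: _); apply/setDidPl; rewrite disjoint_sym disjoints1.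
have [|w wY dw] := mult_essential_exists e_sym e_irr (t := t) (V := Y :|: K :\ a); first lia.
have aYK : a \in Y :|: K by rewrite inE aK orbT.
have /eqP : mult t e ((Y :|: K) :\ a) == (mult t e (Y :|: K)).+1.
  apply/(positiveP t (matchsys_matchpoly e_sym e_irr R) aYK); exists w; rewrite E; split=> //.
  by apply: univ => //; apply: contraTneq wY => <-; rewrite !inE (negPf aY) eqxx.
by rewrite E; lia.
Qed.

End UniversalVertices.

(** * The drop by one in [S], read off the components of [V - A] *)

Theorem theorem5p7 (T : finType) (e : rel T) (V : {set T})
  (R : rcfType) (theta : R)
  (e_sym : symmetric e) (e_irr : irreflexive e)
  (hmult : (2 <= mult theta e V)%N)
  (u v : T) (uV : u \in V) (vV : v \in V) (uv : u != v) :
  let A := special_set theta e V in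
  let B := essential_set theta e V in
  let N := neutral_set theta e V in
  let S := S_rel theta e V in
  (mult theta S (V :\: [set u; v])).+1 = mult theta S V <->
  ( ((u \in N) && (v \in B)) || ((v \in N) && (u \in B))
  \/ exists2 H, H \in components e (V :\: A) &
       [&& critical e theta H, u \in H, v \in H &
           mult theta e (H :\: [set u; v]) == 0%N] ).
Proof.
move=> A B N S; set W := V :\: A; pose mu := mult theta e.
have S_sym : symmetric S.
  by move=> x y; rewrite /S /S_rel e_sym eq_sym [(x \in _) || _]orbC.
have S_irr : irreflexive S by move=> x; rewrite /S /S_rel e_irr eqxx.
have AV : A \subset V by apply/subsetP => x /(specialP e_sym e_irr) [].
have [WE WvE] : mu W = (mu V + #|A|)%N /\
  forall x, x \in W -> mu (W :\ x) = (mu (V :\ x) + #|A|)%N.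
  exact: mult_del_special.
(* [S] agrees with [e] on [W], and the vertices of [A] outside [X] are universal in [S]. *)
have mS (X : {set T}) : (#|A :\: X| <= mu (W :\: X))%N ->
    (mult theta S (V :\: X) + #|A :\: X|)%N = mu (W :\: X).
  have -> : mu (W :\: X) = mult theta S (W :\: X).
    congr mup; apply: (matchsys_ext (matchsys_matchpoly e_sym e_irr R))
      (matchsys_matchpoly S_sym S_irr R) _.
    move=> x y /setDP [/setDP [_ xA] _] /setDP [/setDP [_ yA] _].
    by rewrite /S /S_rel (negPf xA) (negPf yA) andbF orbF.
  move=> h; rewrite -(mult_universal S_sym S_irr _ _ h).
  - by rewrite -setDUl setUC -{2}(setIidPr AV) setID.
  - rewrite -setI_eq0; apply/eqP/setP => x; rewrite !(in_setI, in_setD, in_set0).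
    by case: (x \in A); rewrite ?andbF.
  - by move=> a /setDP [aA _] x ax; rewrite /S /S_rel ax aA orbT.
have muS : (mult theta S V + #|A|)%N = mu W.
  by have := mS set0; rewrite !setD0; apply; rewrite WE leq_addl.
have D1out (x : T) (X : {set T}) : x \notin X -> X :\ x = X.
  by move=> xX; apply/setDidPl; rewrite disjoint_sym disjoints1.
have Wdel (x : T) X : (mu X <= (mu (X :\ x)).+1)%N.
  have [xX|xX] := boolP (x \in X); first exact: (mult_D1 theta e_sym e_irr xX).1.
  by rewrite D1out.
have cA : (#|A :\: [set u; v]| <= #|A|)%N by rewrite subset_leq_card ?subsetDl.
have Wuv : (mu W <= (mu (W :\: [set u; v])).+2)%N.
  by rewrite -setDDl (leq_trans (Wdel u W)) // ltnS.
(* By [hmult], [mu W] is at least [#|A| + 2], so deleting two vertices leaves enough for [mS]. *)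
have muSuv : (mult theta S (V :\: [set u; v]) + #|A :\: [set u; v]|)%N = mu (W :\: [set u; v]).
  by apply: mS; move: hmult WE; rewrite -/(mu V); lia.
have inA x y : x \in A -> y \in V -> (mu W <= (mu (W :\: [set x; y])).+1)%N /\
    (#|A :\: [set x; y]| < #|A|)%N.
  move=> xA yV; split.
    by rewrite -setDDl (D1out x W) // in_setD xA.
  rewrite [#|A|](cardsD1 x) xA ltnS subset_leq_card //.
  by apply: setDS; rewrite subsetUl.
have AN x : x \in A -> (x \in N) = false.
  by move=> xA; rewrite inE (special_mult e_sym e_irr xA) gtn_eqF ?andbF.
have NB x : x \in N -> (x \in B) = false.
  by rewrite !inE => /andP [_ /eqP ->]; rewrite gtn_eqF ?andbF.
have AB x : x \in A -> (x \in B) = false by rewrite inE => /and3P [_ /negbTE ->].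
have AH x H : x \in A -> H \in components e W -> x \in H -> False.
  move=> xA /imsetP [y yW ->] /(subsetP (component_sub _ _ _)).
  by rewrite in_setD xA.
(* Deleting a vertex of [A] leaves [W] unchanged and removes a universal vertex of [S], so the
   multiplicity in [S] cannot fall. Such a vertex is neither neutral nor essential and lies in no
   component of [W]: (a) and (b) fail too. *)
have [uA|uA] := boolP (u \in A).
  have [h1 h2] := inA u v uA vV; split; first by clear -muS muSuv h1 h2; lia.
  rewrite (AN u) // (AB u) // andbF => -[//|[H Hc /and3P [_ uH _]]].
  by case: (AH u H).
have [vA|vA] := boolP (v \in A).
  have [] := inA v u vA uV; rewrite [ [set v; u] ]setUC => h1 h2; split; first by clear -muS muSuv h1 h2; lia.
  rewrite (AN v) // (AB v) // andbF => -[//|[H Hc /and4P [_ _ vH _]]].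
  by case: (AH v H).
have uW : u \in W by rewrite in_setD uA.
have vW : v \in W by rewrite in_setD vA.
have red : (mult theta S (V :\: [set u; v])).+1 = mult theta S V <->
    (mu (W :\: [set u; v])).+1 = mu W.
  have EA : A :\: [set u; v] = A by rewrite -setDDl (D1out u) ?D1out.
  by rewrite EA in muSuv; clear -muS muSuv; lia.
apply: (iff_trans red).
have BE x : x \in W -> (x \in B) = ((mu (W :\ x)).+1 == mu W).
  by move=> xW; rewrite /B -(essential_set_delspecial theta e_sym e_irr) essentialE.
have NE x : x \in W -> (x \in N) = (mu (W :\ x) == mu W).
  move=> xW; rewrite WE WvE // eqn_add2r inE.
  by have /setDP [-> _] := xW.
pose H := component e W u.
have HE X : mu (W :\: X) = (mu (H :\: X) + mu (W :\: H :\: X))%N.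
  exact: mult_component.
have uH : u \in H by apply: mem_component.
have WHE : mu W = (mu H + mu (W :\: H))%N by have := HE set0; rewrite !setD0.
have HxE x : x \in H -> mu (W :\ x) = (mu (H :\ x) + mu (W :\: H))%N.
  by move=> xH; rewrite HE (D1out x (W :\: H)) // in_setD xH.
have compE H' : H' \in components e W -> u \in H' -> H' = H.
  by case/imsetP => y yW -> uy; rewrite /H (component_eq e_sym uy).
(* In different components the two changes add up, each being -1, 0 or 1; the sum is -1 exactly when
   one is 0 and the other -1. *)
have [vH|vH] := boolP (v \in H); last first.
  have e1 : mu (W :\ v) = (mu H + mu (W :\: H :\ v))%N by rewrite HE (D1out v H).
  have e2 : mu (W :\: [set u; v]) = (mu (H :\ u) + mu (W :\: H :\ v))%N.
    rewrite HE -!setDDl (D1out u (W :\: H)) ?in_setD ?uH //.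
    by rewrite (D1out v (H :\ u)) // in_setD1 (negPf vH) andbF.
  have := HxE u uH; rewrite !BE // !NE // => e3.
  have := mult_D1 theta e_sym e_irr uW; have := mult_D1 theta e_sym e_irr vW.
  rewrite -/mu => i1 i2.
  have nb : ~ exists2 H', H' \in components e W &
      [&& critical e theta H', u \in H', v \in H' & mult theta e (H' :\: [set u; v]) == 0%N].
    by case=> H' /compE E /and4P [_ /E -> vH' _]; rewrite vH' in vH.
  by split=> [h|[h|/nb//]]; [left|]; clear -h e1 e2 e3 i1 i2 WHE; lia.
have HuvE : mu (W :\: [set u; v]) = (mu (H :\: [set u; v]) + mu (W :\: H))%N.
  by rewrite HE; congr (_ + mu _)%N; rewrite -setDDl (D1out u) ?D1out // in_setD ?uH ?vH.
have allB x y : x \in H -> y \in H -> (x \in B) = (y \in B).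
  rewrite /B -(essential_set_delspecial theta e_sym e_irr) => xH yH.
  exact: (essential_component e_sym (special_set_delspecial theta e_sym e_irr V) xH yH).
have HW x : x \in H -> x \in W := subsetP (component_sub e W u) x.
have BH x : x \in H -> (x \in B) = ((mu (H :\ x)).+1 == mu H).
  by move=> xH; rewrite BE ?HW // HxE // WHE -addSn eqn_add2r.
have crit1 : critical e theta H -> mu H = 1%N.
  case/andP=> cH /eqP eH.
  apply: (gallai (matchsys_matchpoly e_sym e_irr R) e_irr cH) => x xH.
  by apply/eqP; rewrite -essentialE ?eH.
split=> [h|[|[H' /compE E /and4P [cr /E EH _ /eqP]]]].
(* The drop forces [mu H > 0], hence an essential vertex in [H]; then all of [H] is essential, so
   [H] is critical and [mu H = 1] by [gallai]. *)
- right; exists H; first by apply/imsetP; exists u.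
  have mH0 : (0 < mu H)%N by move: h; rewrite HuvE WHE; clear; lia.
  have [x xH /eqP] := mult_essential_exists e_sym e_irr mH0.
  rewrite -BH // => xB.
  have cr : critical e theta H.
    rewrite /critical component_connected //=; apply/eqP/setP => y.
    apply/idP/idP => [|yH]; first by rewrite inE => /andP [].
    by rewrite essentialE // -BH // (allB y x).
  by rewrite cr uH vH /=; move: h (crit1 cr); rewrite HuvE WHE -/mu; clear; lia.
(* Case (a) cannot occur here: one component would contain a neutral and an essential vertex. *)
- by case/orP=> /andP [/NB nb]; [rewrite -(allB u v) | rewrite (allB u v)]; rewrite // nb.
- by rewrite EH -/(mu _) => z; rewrite HuvE z WHE crit1 // -EH.
Qed.
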